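(* Let $l\ge 1$ and let $A$ be an $l\times l$ Jordan block over $\mathbb{C}$ with an eigenvalue $\lambda$ satisfying $|\lambda|=1$, acting on $\mathbb{C}^l$. (i) If $l=1$ then $J(0)=\{0\}$. If $l>1$ and $l$ is of the form $l=2r$ or $l=2r+1$ with $r$ a positive integer, then $J(0)=\mathbb{C}^r\times\{0\}^{l-r}$. Here $J(0)$ is taken under $A$. (ii) A point $y\in\mathbb{C}^l$ belongs to $J(0)$ (under $A$) if and only if there exists a sequence $\{x_n\}\subset\mathbb{C}^l$ such that $x_n\to 0$ and $A^n x_n\to y$; hence $J(0)=J^{mix}(0)$. (iii) For every linear map $B:\mathbb{C}^l\to\mathbb{C}^l$ all of whose eigenvalues have modulus $1$, the set $J(0)$ taken under $B$ is a proper linear subspace of $\mathbb{C}^l$.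
   Context: An $l\times l$ Jordan block with eigenvalue $\lambda$ is the matrix with all main diagonal entries equal to $\lambda$, all entries on the diagonal just above the main diagonal equal to $1$, and all other entries $0$. For a linear map $T:\mathbb{C}^l\to\mathbb{C}^l$ and $x\in\mathbb{C}^l$, the extended limit set and the extended mixing limit set of $x$ under $T$ are $J(x)=\{y\in\mathbb{C}^l:$ there exist a strictly increasing sequence of positive integers $\{k_n\}$ and a sequence $\{x_n\}\subset\mathbb{C}^l$ such that $x_n\to x$ and $T^{k_n}x_n\to y\}$, $J^{mix}(x)=\{y\in\mathbb{C}^l:$ there exists a sequence $\{x_n\}\subset\mathbb{C}^l$ such that $x_n\to x$ and $T^{n}x_n\to y\}$. *)

(* Defs.v *)
From HB Require Import structures.
From mathcomp Require Import all_boot all_order all_algebra.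
From mathcomp Require Import all_classical all_reals all_analysis.
From mathcomp Require Import complex.
Import Order.TTheory GRing.Theory Num.Theory numFieldNormedType.Exports.

Set Implicit Arguments.
Unset Strict Implicit.
Unset Printing Implicit Defensive.

Local Open Scope classical_set_scope.
Local Open Scope ring_scope.
Local Open Scope complex_scope.

(* The usual topology of the complex numbers, given by the modulus; column
   vectors then carry the entrywise (product) topology. *)
HB.instance Definition _ (R : realType) := NormedModule.copy R[i] R[i]^o.

Definition jordan_block (R : realType) (l : nat) (lambda : R[i]) : 'M[R[i]]_l :=
  \matrix_(i, j) (if j == i :> nat then lambda
                  else if j == i.+1 :> nat then 1 else 0).

Section LimitSets.
Variables (R : realType) (l : nat).
Variables (T : {linear 'cV[R[i]]_l -> 'cV[R[i]]_l}) (x : 'cV[R[i]]_l).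

Definition extended_limit_set : set 'cV[R[i]]_l :=
  [set y | exists (k : nat -> nat) (u : nat -> 'cV[R[i]]_l),
     [/\ forall n, (0 < k n)%N,
         {homo k : m n / (m < n)%N},
         u n @[n --> \oo] --> x &
         iter (k n) T (u n) @[n --> \oo] --> y]].

Definition extended_mixing_limit_set : set 'cV[R[i]]_l :=
  [set y | exists u : nat -> 'cV[R[i]]_l,
     u n @[n --> \oo] --> x /\ iter n T (u n) @[n --> \oo] --> y].

End LimitSets.

(* $\mathbb{C}^r \times \{0\}^{l-r}$ as a subset of $\mathbb{C}^l$ *)
Definition coord_subspace (R : realType) (l r : nat) : set 'cV[R[i]]_l :=
  [set y | forall i : 'I_l, (r <= i)%N -> y i 0 = 0].

(* Main.v *)
Require Import Defs.
From HB Require Import structures.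
From mathcomp Require Import all_boot all_order all_algebra.
From mathcomp Require Import all_classical all_reals all_analysis.
From mathcomp Require Import complex ring zify.
Import Order.TTheory GRing.Theory Num.Theory numFieldNormedType.Exports.

Set Implicit Arguments.
Unset Strict Implicit.
Unset Printing Implicit Defensive.

Local Open Scope classical_set_scope.
Local Open Scope ring_scope.
Local Open Scope complex_scope.

(** Let r be half of l, rounded down. A Jordan block with eigenvalue lambda is
    similar to lambda times the translation f(X) |-> f(X + 1) on polynomials of
    degree less than l, with the coordinate subspaces corresponding to the
    subspaces of polynomials of bounded degree ([jordan_block_shift]); and the
    factor lambda, having modulus 1, can be absorbed into the vectors tending to
    0 ([limit_along_scale]). So everything is a question about polynomials: which
    g are limits of f_n(X + k_n) with f_n tending to 0?

    Every g of degree less than r is one, even with k_n = n, thanks to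
    f_n = (X / n)^r g(X - n) ([shift_limit_lower]). No other g is: after rescaling
    X by k_n, the translation is by 1, and Hermite interpolation at 0 and 1
    bounds the coefficients of f_n(X + k_n) of index at least r by those of f_n
    and by those of index less than r, with powers of k_n that force the former
    to tend to 0 ([hermite_expansion], [shift_limit_upper]). Hence the
    two limit sets of a Jordan block coincide and are the coordinate subspace
    spanned by the first r basis vectors.

    A general operator is a sum of Jordan blocks: [jordan_summand] splits
    one off, using a vector and a linear form whose chains are dually paired
    ([cyclic_pairing_unit]). Since limit sets are functorial for intertwiners,
    the equality of the extended and of the mixing limit sets passes from the
    blocks to the operator ([limit_along_mixing]), and a mixing limit set is a
    linear subspace. It is contained in the kernel of every left eigenvector,
    hence proper ([extended_limit_set_vspace]). *)

(** * Jordan chains and intertwiners *)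

Lemma sum_jordan_block (R : realType) (V : lmodType R[i]) l (lambda : R[i])
    (F : nat -> V) (i : 'I_l) : F l = 0 ->
  \sum_(j < l) jordan_block l lambda i j *: F j = lambda *: F i + F i.+1.
Proof.
move=> Fl0; rewrite (bigD1 i)//= mxE eqxx; congr (_ + _).
have [il|] := ltnP i.+1 l; last first.
  move=> li; have {li} il : i.+1 = l by apply/eqP; rewrite eqn_leq ltn_ord li.
  rewrite il Fl0 big1// => j ji.
  rewrite mxE -[j == i :> nat]/(j == i) (negbTE ji) il.
  by rewrite (ltn_eqF (ltn_ord j)) scale0r.
rewrite (bigD1 (Ordinal il)) /=; last by rewrite -val_eqE/= gtn_eqF.
rewrite big1 ?addr0; first by rewrite mxE/= gtn_eqF// eqxx scale1r.
move=> j /andP[ji ji1]; rewrite mxE -[j == i :> nat]/(j == i) (negbTE ji).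
rewrite -[j == i.+1 :> nat]/(j == Ordinal il).
by rewrite (negbTE ji1) scale0r.
Qed.

Definition cyclic_rows (F : fieldType) (m n : nat) (N : 'M[F]_n)
  (phi : 'rV[F]_n) : 'M[F]_(m, n) := \matrix_(i < m) (phi *m N ^+ i).

(** The exponents decrease along the columns because the nilpotent
    part of a Jordan block sends each basis vector to the one before it. *)
Definition cyclic_cols (F : fieldType) (m n : nat) (N : 'M[F]_n)
    (v : 'cV[F]_n) : 'M[F]_(n, m) :=
  \matrix_(i, j) ((N ^+ (m - j.+1) *m v) i 0).

Lemma col_cyclic_cols (F : fieldType) (m n : nat) (N : 'M[F]_n)
    (v : 'cV[F]_n) j :
  col j (cyclic_cols m N v) = N ^+ (m - j.+1) *m v.
Proof. by apply/colP => i; rewrite !mxE. Qed.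

Lemma cyclic_rows_intertwines (R : realType) m n (B : 'M[R[i]]_n)
    (lambda : R[i]) (phi : 'rV_n) : phi *m (B - lambda%:M) ^+ m = 0 ->
  let P := cyclic_rows m (B - lambda%:M) phi in
  P *m B = jordan_block m lambda *m P.
Proof.
set N := B - _ => phiN /=; apply/row_matrixP => i.
rewrite row_mul rowK [RHS](_ : _ = \sum_(j < m) jordan_block m lambda i j *: (phi *m N ^+ j)).
  rewrite (@sum_jordan_block _ _ _ _ (fun j => phi *m N ^+ j))//.
  rewrite -{1}(subrK lambda%:M B) -/N mulmxDr mul_mx_scalar addrC; congr (_ + _).
  by rewrite exprSr mulmxA.
by rewrite row_mul mulmx_sum_row; apply: eq_bigr => j _; rewrite rowK mxE.
Qed.

Lemma cyclic_cols_intertwines (R : realType) m n (B : 'M[R[i]]_n)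
    (lambda : R[i]) (v : 'cV_n) : (B - lambda%:M) ^+ m *m v = 0 ->
  let E := cyclic_cols m (B - lambda%:M) v in
  B *m E = E *m jordan_block m lambda.
Proof.
set N := B - _ => Nv /=.
have key (j : 'I_m) : B *m (N ^+ (m - j.+1) *m v) =
    lambda *: (N ^+ (m - j.+1) *m v) + N ^+ (m - j) *m v.
  rewrite -{1}(subrK lambda%:M B) -/N mulmxDl mul_scalar_mx addrC; congr (_ + _).
  by rewrite mulmxA -[N *m _]/(N * _) -exprS -subSn ?ltn_ord// subSS.
apply/matrixP => a j.
have -> : (B *m cyclic_cols m N v) a j = (B *m (N ^+ (m - j.+1) *m v)) a 0.
  by rewrite !mxE; apply: eq_bigr => k _; rewrite !mxE.
rewrite key mxE [in RHS]mxE (bigD1 j)//=; congr (_ + _).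
  by rewrite !mxE eqxx mulrC.
case: j {key} => [[|j] jm] /=.
  rewrite subn0 Nv mxE big1// => k; rewrite -val_eqE/= => kj.
  by rewrite [jordan_block _ _ _ _]mxE/= eq_sym (negbTE kj) mulr0.
rewrite (bigD1 (Ordinal (ltnW jm)))/=; last by rewrite -val_eqE/= ltn_eqF.
rewrite [cyclic_cols _ _ _ _ _]mxE [jordan_block _ _ _ _]mxE/= gtn_eqF// eqxx mulr1.
rewrite big1 ?addr0// => k /andP[kj kj1].
rewrite [jordan_block _ _ _ _]mxE/= eq_sym eqSS [j == k :> nat]eq_sym.
by rewrite -!val_eqE/= in kj kj1; rewrite (negbTE kj) (negbTE kj1) mulr0.
Qed.

(** The pairing matrix has entries phi N^(i + m - 1 - j) v: zero below the
    diagonal because N^m kills v, and the nonzero constant phi N^(m-1) v on it.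
    This is what makes a Jordan chain a direct summand: an invariant complement
    of the chain is the kernel of the rows paired with it. *)
Lemma cyclic_pairing_unit (F : fieldType) m n (N : 'M[F]_n)
    (phi : 'rV_n) (v : 'cV_n) : N ^+ m *m v = 0 ->
  (phi *m N ^+ m.-1 *m v) 0 0 != 0 ->
  cyclic_rows m N phi *m cyclic_cols m N v \in unitmx.
Proof.
move=> Nv c0; set H := _ *m _.
have HE i j : H i j = (phi *m (N ^+ (i + (m - j.+1)) *m v)) 0 0.
  rewrite exprD -[N ^+ i * _]/(N ^+ i *m _) -!mulmxA [in RHS]mulmxA.
  rewrite -col_cyclic_cols /H !mxE; apply: eq_bigr => k _.
  by rewrite !mxE.
rewrite -unitmx_tr unitmxE det_trig; last first.
  apply/is_trig_mxP => i j ij; rewrite mxE HE.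
  suff -> : N ^+ (j + (m - i.+1)) *m v = 0 by rewrite mulmx0 mxE.
  have -> : (j + (m - i.+1) = (j - i.+1) + m)%N.
    by rewrite addnBA ?ltn_ord// addnBAC.
  by rewrite exprD -[_ * _]/(_ *m _) -mulmxA Nv mulmx0.
rewrite unitfE prodf_seq_neq0; apply/allP => i _ /=.
rewrite mxE HE subnS -subn1 addnBA ?subn_gt0// subnKC; last exact/ltnW.
by rewrite subn1 mulmxA.
Qed.

(** * Splitting a Jordan block off an endomorphism *)

Lemma horner_mx_powXsubC (F : comNzRingType) n (B : 'M[F]_n.+1) (lambda : F) k :
  horner_mx B (('X - lambda%:P) ^+ k) = (B - lambda%:M) ^+ k.
Proof. by rewrite rmorphXn rmorphB/= horner_mx_X horner_mx_C. Qed.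

(** With p = q (X - lambda)^m of minimal size among the nonzero polynomials such
    that p(B) e = 0, the polynomial q^2 (X - lambda)^(m-1) cannot do the same: q
    is prime to X - lambda, so by Bezout q (X - lambda)^(m-1), which is smaller
    than p, would do it too. The square of q lets one factor q(B) act on a vector
    and the other on a linear form. *)
Lemma primary_component (F : closedFieldType) n (B e : 'M[F]_n.+1) : e != 0 ->
  exists (lambda : F) (m : nat) (q : {poly F}), [/\ (0 < m)%N,
    horner_mx B (q * ('X - lambda%:P) ^+ m) *m e = 0 &
    horner_mx B (q * q * ('X - lambda%:P) ^+ m.-1) *m e != 0].
Proof.
move=> e0.
have : exists2 p, p != 0 & horner_mx B p *m e = 0.
  exists (char_poly B); first by rewrite monic_neq0 ?char_poly_monic.
  by rewrite Cayley_Hamilton mul0mx.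
case=> p; have [s] := ubnP (size p); elim: s p => // s IHs p ps p0 pBe.
have [p1|] := boolP (size p == 1%N).
  have /size_poly1P[c c0 pc] := p1; move/eqP: pBe.
  by rewrite pc horner_mx_C mul_scalar_mx scaler_eq0 (negbTE c0) (negbTE e0).
move=> /closed_rootP[lambda rp].
have [m [q]] := multiplicity_XsubC p lambda; rewrite p0/= => rq pq.
have m0 : (0 < m)%N.
  by case: m pq rp => // pq; rewrite pq expr0 mulr1 (negbTE rq).
have [fe|fe] := eqVneq (horner_mx B (q * q * ('X - lambda%:P) ^+ m.-1) *m e) 0; last first.
  by exists lambda, m, q; split=> //; rewrite -pq.
apply: (IHs (q * ('X - lambda%:P) ^+ m.-1)).
- have q0 : q != 0 by apply: contraNneq rq => ->; rewrite root0.
  have X0 k : ('X - lambda%:P) ^+ k != 0 by rewrite expf_neq0 ?polyXsubC_eq0.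
  rewrite -ltnS (leq_trans _ ps)// ltnS pq -[in X in (_ < X)%N](prednK m0) exprSr mulrA.
  by rewrite [in X in (_ < X)%N]size_Mmonic ?monicXsubC ?mulf_neq0// size_XsubC addn2.
- have q0 : q != 0 by apply: contraNneq rq => ->; rewrite root0.
  by rewrite mulf_neq0// expf_neq0 ?polyXsubC_eq0.
have /Bezout_eq1_coprimepP[[u v] /= uv] : coprimep q ('X - lambda%:P).
  by rewrite coprimep_XsubC.
have -> : q * ('X - lambda%:P) ^+ m.-1 =
    u * (q * q * ('X - lambda%:P) ^+ m.-1) + v * p.
  have -> : p = q * ('X - lambda%:P) ^+ m.-1 * ('X - lambda%:P).
    by rewrite -mulrA -exprSr prednK.
  by rewrite -[LHS]mul1r -uv; ring.
rewrite rmorphD (rmorphM _ u) (rmorphM _ v)/= mulmxDl.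
by rewrite -[_ *m e]mulmxA fe -[_ *m e]mulmxA pBe !mulmx0 addr0.
Qed.

(** The inductive step of the Jordan decomposition, phrased for the summand that
    is the image of an idempotent e of the commutant of B. If the (i, j) entry of
    q(B)^2 (B - lambda)^(m-1) e is nonzero, the vector v = q(B) e e_j and the form
    phi = e_i^T e q(B) are both killed by (B - lambda)^m while
    phi (B - lambda)^(m-1) v is nonzero. Their chains give intertwiners E and P
    with P E invertible, and the inverse commutes with the Jordan block, so it
    can be absorbed into E. Then E P is an idempotent below e. *)
Lemma jordan_summand (R : realType) n (B e : 'M[R[i]]_n.+1) :
  e *m e = e -> e *m B = B *m e -> e != 0 ->
  exists (m : nat) (lambda : R[i]) (E : 'M[R[i]]_(n.+1, m)) (P : 'M[R[i]]_(m, n.+1)),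
  [/\ (0 < m)%N, exists2 v : 'cV_n.+1, v != 0 & B *m v = lambda *: v,
      B *m E = E *m jordan_block m lambda /\ P *m B = jordan_block m lambda *m P,
      e *m E = E /\ P *m e = P & P *m E = 1%:M].
Proof.
move=> ee eB e0; have [lambda [m [q [m0 qNm qqN]]]] := primary_component B e0.
set N := B - lambda%:M.
have comm_hB p : e *m horner_mx B p = horner_mx B p *m e.
  exact: (comm_mx_horner p (eB : comm_mx e B)).
have eN k : e *m N ^+ k = N ^+ k *m e by rewrite -horner_mx_powXsubC.
have [i [j ij]] : exists i j, (horner_mx B (q * q * ('X - lambda%:P) ^+ m.-1) *m e) i j != 0.
  move: qqN; apply: contra_neqP => /forallNP ijN; apply/matrixP => i j.
  by rewrite [RHS]mxE; apply: contrapT => /eqP ij; apply: (ijN i); exists j.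
pose v : 'cV_n.+1 := horner_mx B q *m e *m delta_mx j 0.
pose phi : 'rV_n.+1 := delta_mx 0 i *m e *m horner_mx B q.
have Nv : N ^+ m *m v = 0.
  rewrite /v !mulmxA -horner_mx_powXsubC -[_ *m horner_mx _ _]rmorphM/=.
  by rewrite mulrC qNm mul0mx.
have phiN : phi *m N ^+ m = 0.
  rewrite /phi -!mulmxA -horner_mx_powXsubC -[_ *m horner_mx _ _]rmorphM/=.
  by rewrite comm_hB qNm mulmx0.
have qNq : horner_mx B q *m N ^+ m.-1 *m horner_mx B q =
    horner_mx B (q * q * ('X - lambda%:P) ^+ m.-1).
  rewrite -horner_mx_powXsubC -[X in X *m _]rmorphM -[LHS]rmorphM/=.
  by congr (horner_mx B _); ring.
have c0 : (phi *m N ^+ m.-1 *m v) 0 0 != 0.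
  have eqNqe : e *m horner_mx B q *m N ^+ m.-1 *m horner_mx B q *m e =
      horner_mx B (q * q * ('X - lambda%:P) ^+ m.-1) *m e.
    by rewrite -3!(mulmxA e) mulmxA qNq comm_hB -mulmxA ee.
  have -> : phi *m N ^+ m.-1 *m v = delta_mx 0 i *m
      (horner_mx B (q * q * ('X - lambda%:P) ^+ m.-1) *m e) *m delta_mx j 0.
    by rewrite -eqNqe /phi /v !mulmxA.
  by rewrite -rowE -colE mxE mxE.
have EJ := cyclic_cols_intertwines Nv; have PJ := cyclic_rows_intertwines phiN.
have Hu := cyclic_pairing_unit Nv c0.
rewrite -/N in EJ PJ; set E := cyclic_cols _ _ _ in EJ Hu.
set P := cyclic_rows _ _ _ in PJ Hu.
have HJ : P *m E *m jordan_block m lambda = jordan_block m lambda *m (P *m E).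
  by rewrite -mulmxA -EJ mulmxA PJ mulmxA.
exists m, lambda, (E *m invmx (P *m E)), P; split=> //.
- exists (N ^+ m.-1 *m v).
    by apply: contraNneq c0 => c0; rewrite -mulmxA c0 mulmx0 mxE.
  apply/eqP; rewrite -subr_eq0 -mul_scalar_mx -mulmxBl -/N mulmxA.
  by rewrite -[N *m _]/(N * _) -exprS prednK// Nv.
- split=> //; rewrite mulmxA EJ -[LHS]mulmxA -[RHS]mulmxA; congr (_ *m _).
  apply: (can_inj (mulKmx Hu)); rewrite !mulmxA HJ mulmxK//.
  by rewrite mulmxV// mul1mx.
- split; last first.
    apply/row_matrixP => k; rewrite row_mul rowK -mulmxA -eN mulmxA /phi.
    by congr (_ *m _); rewrite -mulmxA -comm_hB mulmxA -[_ *m e *m e]mulmxA ee.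
  rewrite mulmxA; congr (_ *m _).
  apply: trmx_inj; apply/row_matrixP => k; rewrite -!tr_col; congr (_^T).
  rewrite colE -mulmxA -colE col_cyclic_cols mulmxA eN -mulmxA; congr (_ *m _).
  by rewrite /v !mulmxA comm_hB -[X in X *m _]mulmxA ee.
by rewrite mulmxA mulmxV.
Qed.
(** * The translation of polynomials and Hermite interpolation *)

(** The translation f(X) |-> f(X + 1) in the basis of the powers of X. *)
Definition shift_mx (R : realType) l : 'M[R[i]]_l := \matrix_(i, j) 'C(j, i)%:R.

Definition coef_vec (R : realType) l (p : {poly R[i]}) : 'cV[R[i]]_l :=
  \col_i p`_i.

Lemma coef_vec_surj (R : realType) l (x : 'cV[R[i]]_l) :
  exists2 p : {poly R[i]}, (size p <= l)%N & x = coef_vec l p.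
Proof.
exists (rVpoly x^T); first exact: size_poly.
by apply/colP => i; rewrite mxE coef_rVpoly_ord mxE.
Qed.

Lemma shift_mxE (R : realType) l (p : {poly R[i]}) : (size p <= l)%N ->
  shift_mx R l *m coef_vec l p = coef_vec l (p \Po ('X + 1)).
Proof.
move=> pl; apply/colP => i; rewrite !mxE.
have -> : p \Po ('X + 1) = \sum_(j < l) p`_j *: ('X + 1) ^+ j.
  rewrite comp_polyE (big_ord_widen_cond l xpredT (fun j => p`_j *: ('X + 1) ^+ j))//.
  rewrite [RHS](bigID (fun j : 'I_l => (j < size p)%N))/= [X in _ = _ + X]big1 ?addr0//.
  by move=> j; rewrite -leqNgt => /(nth_default 0)->; rewrite scale0r.
rewrite coef_sum; apply: eq_bigr => j _; rewrite !mxE coefZ mulrC; congr (_ * _).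
rewrite exprD1n coef_sum (eq_bigr (fun k : 'I_j.+1 => (i == k :> nat)%:R *+ 'C(j, k))).
  have [ij|ij] := ltnP i j.+1.
    rewrite (bigD1 (Ordinal ij))//= eqxx big1 ?addr0// => k.
    by rewrite -val_eqE/= eq_sym => /negbTE->; rewrite mul0rn.
  rewrite bin_small// big1// => k _; rewrite gtn_eqF ?mul0rn//.
  exact: leq_trans (ltn_ord k) ij.
by move=> k _; rewrite coefMn coefXn.
Qed.

Lemma shift_mxXE (R : realType) l k (p : {poly R[i]}) : (size p <= l)%N ->
  shift_mx R l ^+ k *m coef_vec l p = coef_vec l (p \Po ('X + k%:R%:P)).
Proof.
elim: k p => [|k IHk] p pl.
  by rewrite mul1mx addr0 comp_polyXr.
rewrite exprSr -[_ * _]/(_ *m _) -mulmxA shift_mxE// IHk; last first.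
  by rewrite size_comp_poly2// -polyC1 size_XaddC.
rewrite -comp_polyA comp_polyD comp_polyX -polyC1 comp_polyC -addrA -polyCD.
by rewrite -mulrSr.
Qed.

Lemma coef_comp_scaleX (F : comNzRingType) (c : F) (p : {poly F}) i :
  (p \Po (c *: 'X))`_i = c ^+ i * p`_i.
Proof.
rewrite coef_comp_poly; have [ip|ip] := ltnP i (size p).
  rewrite (bigD1 (Ordinal ip))//= big1 => [|j].
    by rewrite exprZn coefZ coefXn eqxx mulr1 addr0 mulrC.
  rewrite -val_eqE/= => /negbTE ji.
  by rewrite exprZn coefZ coefXn eq_sym ji !mulr0.
rewrite [p`_i]nth_default// mulr0 big1// => j _.
rewrite exprZn coefZ coefXn gtn_eqF ?mulr0//; exact: leq_trans (ltn_ord j) ip.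
Qed.

(** Sends the coefficients of f to its first p coefficients at 0 followed by its
    first l - p coefficients at 1. *)
Definition hermite_mx (R : realType) p l : 'M[R[i]]_l :=
  \matrix_(i, j) (if (i < p)%N then (j == i)%:R else 'C(j, i - p)%:R).

(** Hermite interpolation: a polynomial with at most l coefficients divisible by
    both X^p and (X - 1)^(l - p), which are coprime, is zero. *)
Lemma hermite_mx_unit (R : realType) p l : (p <= l)%N ->
  hermite_mx R p l \in unitmx.
Proof.
move=> pl; rewrite -unitmx_tr -row_free_unit; apply: inj_row_free => v vH.
have [F Fl Fv] := coef_vec_surj v^T.
have H0 (i : 'I_l) : (hermite_mx R p l *m coef_vec l F) i 0 = 0.
  by rewrite -Fv -[hermite_mx _ _ _]trmxK -trmx_mul vH !mxE.
have S0 (i : nat) : (i < l - p)%N -> (F \Po ('X + 1))`_i = 0.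
  move=> il; have ipl : (i + p < l)%N by rewrite addnC -ltn_subRL.
  have := H0 (Ordinal ipl); rewrite mxE => {2}<-.
  have il' : (i < l)%N by apply: leq_trans il (leq_subr _ _).
  have /colP/(_ (Ordinal il')) := shift_mxE Fl; rewrite [RHS]mxE/= => <-.
  by rewrite mxE; apply: eq_bigr => j _; rewrite !mxE/= ltnNge leq_addl/= addnK.
have F0 (i : nat) : (i < p)%N -> F`_i = 0.
  move=> ip; have il : (i < l)%N by apply: leq_trans pl.
  have := H0 (Ordinal il); rewrite mxE (bigD1 (Ordinal il))//= !mxE/= ip eqxx mul1r.
  by rewrite big1 ?addr0// => j jl; rewrite !mxE/= ip (negbTE jl) mul0r.
have low0 n (G : {poly R[i]}) : (forall i, (i < n)%N -> G`_i = 0) -> 'X^n %| G.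
  move=> G0; rewrite -[G](poly_take_drop n) [take_poly n G](_ : _ = 0) ?add0r ?dvdp_mulIr//.
  apply/polyP => i; rewrite coef_take_poly coef0; case: ifP => // /G0->//.
have XF : 'X^p %| F by apply: low0.
have X1F : ('X - 1) ^+ (l - p) %| F.
  have /dvdpP[G FG] := low0 _ _ S0.
  apply/dvdpP; exists (G \Po ('X - 1)).
  have := congr1 (fun G => G \Po ('X - 1)) FG.
  rewrite -comp_polyA comp_polyD comp_polyX -polyC1 comp_polyC subrK comp_polyXr => ->.
  by rewrite comp_polyM rmorphXn/= comp_polyX.
have cop : coprimep ('X^p : {poly R[i]}) (('X - 1) ^+ (l - p)).
  apply/coprimep_expl/coprimep_expr; rewrite -polyC1 coprimep_XsubC.
  by rewrite rootX oner_eq0.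
have XXF : 'X^p * ('X - 1) ^+ (l - p) %| F by rewrite Gauss_dvdp// XF X1F.
have F00 : F = 0.
  apply: contraTeq Fl => Fn0; rewrite -ltnNge.
  apply: leq_trans (dvdp_leq Fn0 XXF).
  rewrite size_monicM ?monicXn ?expf_neq0 -?polyC1 ?polyXsubC_eq0// size_polyXn.
  by rewrite size_exp_XsubC addSn/= addnS subnKC.
by apply: trmx_inj; rewrite Fv F00; apply/colP => i; rewrite !mxE coef0.
Qed.

(** Rescaling X by k turns the translation by k into the translation by 1, so the
    constants c of Hermite interpolation do not depend on k; all the growth in k
    is in the explicit powers. *)
Lemma hermite_expansion (R : realType) l p : (p <= l)%N ->
  exists c : 'M[R[i]]_l, forall (k : nat) (f : {poly R[i]}) (j : 'I_l),
    (0 < k)%N -> (size f <= l)%N ->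
  let g := f \Po ('X + k%:R%:P) in
  g`_j = \sum_(i < l) c j i * (if (i < p)%N then k%:R ^+ i / k%:R ^+ j * f`_i
                               else k%:R ^+ (i - p) / k%:R ^+ j * g`_(i - p)).
Proof.
move=> pl; exists (shift_mx R l *m invmx (hermite_mx R p l)) => k f j k0 fl g.
have k00 : (k%:R : R[i]) != 0 by rewrite pnatr_eq0 -lt0n.
(* F(X + 1) = g(k X), so its coefficients are those of g times powers of k *)
pose F := f \Po (k%:R *: 'X).
have Fl : (size F <= l)%N.
  by rewrite size_comp_poly2// size_scale// size_polyX.
have FS : F \Po ('X + 1) = g \Po (k%:R *: 'X).
  rewrite /F /g -!comp_polyA comp_polyZ comp_polyX comp_polyD comp_polyX comp_polyC.
  by rewrite scalerDr alg_polyC.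
have SF (i : 'I_l) : (shift_mx R l *m coef_vec l F) i 0 = k%:R ^+ i * g`_i.
  by rewrite shift_mxE// FS mxE coef_comp_scaleX.
apply: (mulfI (expf_neq0 j k00)); rewrite -SF.
have -> : shift_mx R l *m coef_vec l F = shift_mx R l *m invmx (hermite_mx R p l) *m
    (hermite_mx R p l *m coef_vec l F).
  by rewrite -mulmxA mulKmx ?hermite_mx_unit.
rewrite mxE mulr_sumr.
apply: eq_bigr => i _; rewrite [RHS]mulrCA; congr (_ * _).
case ip: (i < p)%N.
  rewrite mulrA mulrCA divff ?expf_neq0// mulr1 mxE (bigD1 i)//= !mxE ip eqxx mul1r.
  rewrite coef_comp_scaleX big1 ?addr0// => i'.
  by move=> /negbTE ii'; rewrite !mxE ip ii' mul0r.
rewrite mulrA mulrCA divff ?expf_neq0// mulr1.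
have il : (i - p < l)%N by apply: leq_ltn_trans (leq_subr _ _) _.
rewrite -[RHS](SF (Ordinal il)) !mxE; apply: eq_bigr => i' _.
by rewrite !mxE ip.
Qed.
(** * Regular nilpotent upper triangular matrices *)

Definition regular_upper (F : fieldType) l (N : 'M[F]_l) :=
  (forall i j : 'I_l, (j <= i)%N -> N i j = 0) /\
  (forall i j : 'I_l, j = i.+1 :> nat -> N i j != 0).

Lemma regular_upperX (F : fieldType) l (N : 'M[F]_l) k :
  regular_upper N -> forall i j : 'I_l,
  ((j < i + k)%N -> (N ^+ k) i j = 0) /\
  (j = (i + k)%N :> nat -> (N ^+ k) i j != 0).
Proof.
case=> N0 N1; elim: k => [|k IHk] i j.
  rewrite expr0 mxE addn0; split=> [ji|/val_inj->]; last by rewrite eqxx oner_eq0.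
  by rewrite -val_eqE/= gtn_eqF.
rewrite exprS mxE addnS; split=> [jik|jik].
  apply: big1 => a _; have [ai|ia] := leqP a i; first by rewrite N0 ?mul0r.
  by rewrite (IHk a j).1 ?mulr0// (leq_trans jik)// -addSn leq_add2r.
have il : (i.+1 < l)%N.
  by apply: leq_ltn_trans (ltn_ord j); rewrite jik -addSn leq_addr.
rewrite (bigD1 (Ordinal il))//= big1 ?addr0 => [|a ai].
  by rewrite mulf_neq0 ?N1// (IHk _ j).2//= addSn.
have [le_ai|ia] := leqP a i; first by rewrite N0 ?mul0r.
rewrite (IHk a j).1 ?mulr0// jik -addSn ltn_add2r ltn_neqAle ia andbT.
by rewrite eq_sym.
Qed.

(** An intrinsic description of the coordinate subspaces: it allows them to be
    transported along an intertwiner of which only invertibility is known. *)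
Lemma regular_upper_ker (R : realType) l (N : 'M[R[i]]_l) r (y : 'cV[R[i]]_l) :
  regular_upper N -> coord_subspace r y <-> N ^+ r *m y = 0.
Proof.
move=> rN; have Nr := regular_upperX r rN; split=> [y0|Ny].
  apply/colP => i; rewrite !mxE big1// => j _.
  have [rj|jr] := leqP r j; first by rewrite y0 ?mulr0.
  by rewrite (Nr i j).1 ?mul0r// ltn_addl.
suff: forall d (i : 'I_l), (l - i <= d)%N -> (r <= i)%N -> y i 0 = 0.
  by move=> y0 i; exact: (y0 (l - i)%N).
elim=> [|d IHd] i lid ri.
  by move: lid; rewrite leqNgt subn_gt0 ltn_ord.
have il : (i - r < l)%N by apply: leq_ltn_trans (leq_subr _ _) _.
have /colP/(_ (Ordinal il)) := Ny; rewrite !mxE (bigD1 i)//= big1 ?addr0 => [|j ji].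
  by move/eqP; rewrite mulf_eq0 (negbTE ((Nr _ _).2 _)) /= ?subnK// => /eqP.
have [lt_ji|lt_ij|/val_inj ij] := ltngtP j i; last by rewrite ij eqxx in ji.
  by rewrite (Nr _ _).1 ?mul0r//= subnK.
rewrite IHd ?mulr0//; last exact: leq_trans (ltnW lt_ij).
by rewrite -ltnS (leq_trans _ lid)// ltn_sub2l.
Qed.

Lemma regular_upper_jordan (R : realType) l (lambda : R[i]) :
  regular_upper (jordan_block l lambda - lambda%:M).
Proof.
split=> i j; rewrite !mxE -val_eqE/= [i == j :> nat]eq_sym.
  move=> ji; case: eqP => [_|_]; first by rewrite mulr1n subrr.
  by rewrite subr0 ltn_eqF.
by move=> ji; rewrite ji eqxx gtn_eqF// subr0 oner_eq0.
Qed.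

Lemma regular_upper_shift (R : realType) l (lambda : R[i]) : lambda != 0 ->
  regular_upper (lambda *: shift_mx R l - lambda%:M).
Proof.
move=> l0; split=> i j; rewrite !mxE.
  rewrite leq_eqVlt => /predU1P[/val_inj->|ji]; first by rewrite binn eqxx mulr1 subrr.
  by rewrite bin_small// -val_eqE gtn_eqF// mulr0 subr0.
move=> ji; rewrite -val_eqE/= ji binSn ltn_eqF// subr0.
by rewrite mulf_neq0// pnatr_eq0.
Qed.

(** The chain of the last basis vector, paired with that of the first coordinate
    form, is already a whole basis: (T - lambda)^(l-1) has a nonzero corner. *)
Lemma regular_upper_similar (R : realType) l (T : 'M[R[i]]_l) (lambda : R[i]) :
  regular_upper (T - lambda%:M) ->
  exists2 E : 'M[R[i]]_l, E \in unitmx & T *m E = E *m jordan_block l lambda.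
Proof.
case: l T => [|l] T rN.
  by exists 1%:M; [exact: unitmx1 | apply/matrixP => -[]].
set N := T - _ in rN; have NX k := regular_upperX k rN.
have N0 : N ^+ l.+1 = 0.
  apply/matrixP => i j; rewrite mxE; apply: (NX _ i j).1.
  by rewrite (leq_trans (ltn_ord j))// leq_addl.
pose v : 'cV[R[i]]_l.+1 := delta_mx ord_max 0.
have Nv : N ^+ l.+1 *m v = 0 by rewrite N0 mul0mx.
exists (cyclic_cols l.+1 N v); last exact: cyclic_cols_intertwines.
have : cyclic_rows l.+1 N (delta_mx 0 ord0) *m cyclic_cols l.+1 N v \in unitmx.
  apply: cyclic_pairing_unit => //=.
  rewrite -rowE -colE mxE mxE; apply: (NX _ _ _).2; exact: add0n.
by rewrite unitmx_mul => /andP[].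
Qed.
(** * Convergence of complex vectors and polynomials *)

Lemma cvg_mx_entries (R : realType) m n (u : nat -> 'M[R[i]]_(m, n)) (x : 'M[R[i]]_(m, n)) :
  u k @[k --> \oo] --> x <-> forall i j, u k i j @[k --> \oo] --> x i j.
Proof.
split=> [ux i j|ux].
  exact: (cvg_comp _ _ ux (@coord_continuous _ _ _ i j x)).
apply/cvg_ballP => e e0.
have : \forall k \near \oo, forall i j, ball (x i j) e (u k i j).
  apply: filter_forall => i; apply: filter_forall => j.
  by have /cvg_ballP := ux i j; apply.
by apply: filterS => k uk; split.
Qed.

Lemma cvg_mulmx (R : realType) m n p (M : 'M[R[i]]_(m, n))
    (u : nat -> 'M[R[i]]_(n, p)) (x : 'M[R[i]]_(n, p)) :
  u k @[k --> \oo] --> x -> M *m u k @[k --> \oo] --> M *m x.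
Proof.
move=> /cvg_mx_entries ux; apply/cvg_mx_entries => i j; rewrite mxE.
under eq_fun do rewrite mxE.
apply: cvg_big => [|a _]; first exact: add_continuous.
by apply: cvgM; [exact: cvg_cst | exact: ux].
Qed.

Lemma cvg_unimodular_scale (R : realType) n (c : nat -> R[i])
    (u : nat -> 'cV[R[i]]_n) :
  (forall k, `|c k| = 1) -> u k @[k --> \oo] --> (0 : 'cV[R[i]]_n) ->
  c k *: u k @[k --> \oo] --> (0 : 'cV[R[i]]_n).
Proof.
move=> c1 /cvg_mx_entries u0; apply/cvg_mx_entries => i j.
have := u0 i j; rewrite !mxE => /cvgr0Pnorm_lt u00.
apply/cvgr0Pnorm_lt => e e0; have := u00 e e0; apply: filterS => k.
by rewrite mxE normrM c1 mul1r.
Qed.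

Lemma cvg_inv_natr (R : realType) (k : nat -> nat) :
  {homo k : m n / (m < n)%N} ->
  ((k n)%:R^-1 : R[i]) @[n --> \oo] --> (0 : R[i]).
Proof.
move=> kinc; have kn n : (n <= k n)%N.
  by elim: n => // n IHn; exact: leq_ltn_trans IHn (kinc _ _ _).
apply/cvgr0Pnorm_lt => e e0.
have er := RRe_real (gtr0_real e0).
have r0 : 0 < complex.Re e by rewrite -ltcR er.
near=> n.
have nr : (complex.Re e)^-1 < n%:R.
  near: n; exact: nbhs_infty_gtr.
have k0 : (0 < k n)%N.
  apply: leq_trans (kn n); rewrite -(ltr_nat R).
  by apply: lt_trans nr; rewrite invr_gt0.
rewrite normfV normr_nat -[ltRHS]invrK ltf_pV2 ?posrE ?invr_gt0 ?ltr0n//.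
rewrite -er -fmorphV -(rmorph_nat (@real_complex R)) ltcR.
by rewrite (lt_le_trans nr)// ler_nat.
Unshelve. all: by end_near. Qed.

(** * Limits along a sequence of exponents *)

(** For fixed exponents these limits form a linear subspace that is functorial
    for intertwiners. Letting k vary over increasing sequences gives the extended
    limit set of 0, and k = id gives the mixing one. *)
Definition limit_along (R : realType) l (B : 'M[R[i]]_l) (k : nat -> nat) :
    set 'cV[R[i]]_l :=
  [set y | exists u : nat -> 'cV[R[i]]_l,
    u n @[n --> \oo] --> (0 : 'cV[R[i]]_l) /\ B ^+ k n *m u n @[n --> \oo] --> y].

Lemma limit_along_intertwine (R : realType) m n (B : 'M[R[i]]_n) (B' : 'M[R[i]]_m)
    (P : 'M[R[i]]_(m, n)) k y :
  P *m B = B' *m P -> limit_along B k y -> limit_along B' k (P *m y).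
Proof.
move=> PB [u [u0 uy]]; exists (fun n => P *m u n).
split; first by have := @cvg_mulmx _ _ _ _ P _ _ u0; rewrite mulmx0.
have PX a : P *m B ^+ a = B' ^+ a *m P.
  elim: a => [|a IHa]; first by rewrite mulmx1 mul1mx.
  rewrite !exprS -[B * _]/(B *m _) -[B' * _]/(B' *m _) mulmxA PB.
  by rewrite -mulmxA IHa mulmxA.
under eq_fun do rewrite mulmxA -PX -mulmxA.
exact: cvg_mulmx.
Qed.

Lemma limit_along0 (R : realType) n (B : 'M[R[i]]_n) k : limit_along B k 0.
Proof.
exists (fun=> 0); split; first exact: cvg_cst.
under eq_fun do rewrite mulmx0.
exact: cvg_cst.
Qed.

Lemma limit_along_linear (R : realType) n (B : 'M[R[i]]_n) k a y z :
  limit_along B k y -> limit_along B k z -> limit_along B k (a *: y + z).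
Proof.
move=> [u [u0 uy]] [v [v0 vz]]; exists (fun n => a *: u n + v n).
have lin (u' v' : nat -> 'cV[R[i]]_n) (y' z' : 'cV[R[i]]_n) :
    u' n @[n --> \oo] --> y' -> v' n @[n --> \oo] --> z' ->
    a *: u' n + v' n @[n --> \oo] --> a *: y' + z'.
  move=> /cvg_mx_entries uy' /cvg_mx_entries vz'; apply/cvg_mx_entries => i j.
  rewrite !mxE; under eq_fun do rewrite !mxE.
  by apply: cvgD => //; apply: cvgM => //; exact: cvg_cst.
split; first by have := lin _ _ _ _ u0 v0; rewrite scaler0 addr0.
under eq_fun do rewrite mulmxDr -scalemxAr.
exact: (lin _ _ _ _ uy vz).
Qed.

(** A unimodular factor c is invisible: c^k can be moved from the operator to the
    vectors, which still tend to 0. *)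
Lemma limit_along_scale (R : realType) n (B : 'M[R[i]]_n) c k y : `|c| = 1 ->
  limit_along (c *: B) k y <-> limit_along B k y.
Proof.
have ZX a (c' : R[i]) (M : 'M[R[i]]_n) : (c' *: M) ^+ a = c' ^+ a *: M ^+ a.
  elim: a => [|a IHa]; first by rewrite !expr0 scale1r.
  by rewrite !exprS IHa -[LHS]scalemxAl -[M * _]/(M *m _) -scalemxAr scalerA.
have imp (c' : R[i]) (M : 'M[R[i]]_n) : `|c'| = 1 ->
    limit_along (c' *: M) k y -> limit_along M k y.
  move=> c1 [u [u0 uy]]; exists (fun m => c' ^+ k m *: u m); split.
    by apply: cvg_unimodular_scale => // m; rewrite normrX c1 expr1n.
  under eq_fun do rewrite -scalemxAr scalemxAl -ZX.
  exact: uy.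
move=> c1; split; first exact: imp.
have c0 : c != 0 by rewrite -normr_eq0 c1 oner_eq0.
rewrite -{1}[B]scale1r -(mulVf c0) -scalerA; apply: imp.
by rewrite normfV c1 invr1.
Qed.

Lemma cvg_poly_mul (R : realType) (f g : nat -> {poly R[i]}) (f' g' : {poly R[i]}) :
  (forall i, (f n)`_i @[n --> \oo] --> f'`_i) ->
  (forall i, (g n)`_i @[n --> \oo] --> g'`_i) ->
  forall i, (f n * g n)`_i @[n --> \oo] --> (f' * g')`_i.
Proof.
move=> ff' gg' i; rewrite coefM; under eq_fun do rewrite coefM.
apply: cvg_big => [|a _]; first exact: add_continuous.
by apply: cvgM.
Qed.

Lemma cvg_poly_exp (R : realType) (f : nat -> {poly R[i]}) (f' : {poly R[i]}) r :
  (forall i, (f n)`_i @[n --> \oo] --> f'`_i) ->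
  forall i, (f n ^+ r)`_i @[n --> \oo] --> (f' ^+ r)`_i.
Proof.
move=> ff'; elim: r => [|r IHr] i.
  by under eq_fun do rewrite expr0; exact: cvg_cst.
under eq_fun do rewrite exprS.
by rewrite exprS; exact: (cvg_poly_mul ff' IHr).
Qed.

Lemma cvg_poly_ZXaddC (R : realType) (e : nat -> R[i]) (c : R[i]) :
  e n @[n --> \oo] --> (0 : R[i]) ->
  forall i, (e n *: 'X + c%:P)`_i @[n --> \oo] --> (c%:P)`_i.
Proof.
move=> e0 i; rewrite -[X in _ --> X]add0r -[X in X + _](mul0r ('X`_i)).
under eq_fun do rewrite coefD coefZ.
apply: cvgD; last exact: cvg_cst.
exact: (cvgM e0 (cvg_cst _)).
Qed.

Lemma cvg_exp_seq (R : realType) (e : nat -> R[i]) (c : R[i]) r :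
  e n @[n --> \oo] --> c -> e n ^+ r @[n --> \oo] --> c ^+ r.
Proof.
move=> ec; elim: r => [|r IHr].
  by under eq_fun do rewrite expr0; exact: cvg_cst.
under eq_fun do rewrite exprS.
by rewrite exprS; exact: (cvgM ec IHr).
Qed.
(** * The translation: exact limit set *)

(** Write f_n for the polynomials tending to 0 and g_n for f_n(X + k_n). Hermite
    interpolation with l - r conditions at 0 and r at 1, where r is half of l,
    expresses the j-th coefficient of g_n through k_n^(i-j) f_n_i with i < l - r
    and k_n^(i-j) g_n_i with i < r. For j >= r the first powers are bounded and
    multiply sequences tending to 0, since l - r <= r + 1; the others tend to 0
    and multiply convergent sequences. *)
Lemma shift_limit_upper (R : realType) l (k : nat -> nat) (y : 'cV[R[i]]_l) :
  {homo k : m n / (m < n)%N} ->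
  limit_along (shift_mx R l) k y -> coord_subspace l./2 y.
Proof.
move=> kinc [u [u0 uy]] j rj.
have /boolp.choice[f fu] : forall n, exists p : {poly R[i]},
    (size p <= l)%N /\ u n = coef_vec l p.
  by move=> n; have [p pl up] := coef_vec_surj (u n); exists p.
pose g n := f n \Po ('X + (k n)%:R%:P).
have f0 (i : 'I_l) : (f n)`_i @[n --> \oo] --> (0 : R[i]).
  have /cvg_mx_entries/(_ i 0) := u0; rewrite mxE.
  by under eq_fun do rewrite (fu _).2 mxE.
have gy (i : 'I_l) : (g n)`_i @[n --> \oo] --> y i 0.
  have /cvg_mx_entries/(_ i 0) := uy.
  by under eq_fun do rewrite (fu _).2 shift_mxXE ?(fu _).1// mxE.
set r := l./2 in rj; pose p := (l - r)%N.
have pr : (p <= r.+1)%N.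
  by rewrite /p /r; lia.
have [c cE] := hermite_expansion R (leq_subr r l).
have e0 := @cvg_inv_natr R k kinc.
(* the expansion with the quotients of powers of k_n turned into powers of
   its inverse, which agrees with it as soon as k_n is positive *)
pose h n := \sum_(i < l) c j i *
  (if (i < p)%N then (k n)%:R^-1 ^+ (j - i) * (f n)`_i
   else (k n)%:R^-1 ^+ (j - (i - p)) * (g n)`_(i - p)).
have pow a i : (0 < a)%N -> (i <= j)%N ->
    (a%:R ^+ i / a%:R ^+ j : R[i]) = a%:R^-1 ^+ (j - i).
  move=> a0 ij; rewrite -[in LHS](subnK ij) exprD invfM mulrCA divff ?mulr1 ?exprVn//.
  by rewrite expf_neq0// pnatr_eq0 -lt0n.
have gh : \forall n \near \oo, h n = (g n)`_j.
  near=> n.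
  have k0 : (0 < k n)%N.
    by apply: leq_ltn_trans (kinc n.-1 n _) => //; rewrite prednK//; near: n; exact: nbhs_infty_gt.
  rewrite (cE _ _ j k0 (fu n).1); apply: eq_bigr => i _; congr (_ * _).
  rewrite -/p; case ip: (i < p)%N; rewrite pow//.
    by rewrite -ltnS (leq_trans ip)// (leq_trans pr).
  by have := ltn_ord i; lia.
have h0 : h n @[n --> \oo] --> (0 : R[i]).
  have -> : (0 : R[i]) = \sum_(i < l) 0 by rewrite big1.
  apply: cvg_big => [|i _]; first exact: add_continuous.
  have ce : (fun=> c j i) @ \oo --> c j i by exact: cvg_cst.
  have ej a := @cvg_exp_seq R _ _ a e0.
  case ip: (i < p)%N.
    have lim0 := cvgM ce (cvgM (ej (j - i)%N) (f0 i)).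
    rewrite [X in _ --> X](_ : _ = c j i * (0 ^+ (j - i) * 0)); last by rewrite !mulr0.
    exact: lim0.
  have ipl : (i - p < l)%N by apply: leq_ltn_trans (leq_subr _ _) _.
  have lim0 := cvgM ce (cvgM (ej (j - (i - p))%N) (gy (Ordinal ipl))).
  have ipj : (j - (i - p) == 0)%N = false by have := ltn_ord i; lia.
  rewrite expr0n ipj mul0r mulr0 in lim0.
  exact: lim0.
apply: (cvg_unique _ (gy j)); first exact: norm_hausdorff.
apply: cvg_trans h0; exact: near_eq_cvg.
Unshelve. all: by end_near. Qed.
(** For q of degree less than r with 2 r <= l, the polynomial (X / n)^r q(X - n)
    has degree less than l; its coefficients tend to 0, those of q(X - n) being
    O(n^(r-1)), and its translate by n is (1 + X / n)^r q(X), which tends to q. *)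
Lemma shift_limit_lower (R : realType) l (y : 'cV[R[i]]_l) :
  coord_subspace l./2 y -> limit_along (shift_mx R l) id y.
Proof.
set r := l./2 => y0; have [q ql yq] := coef_vec_surj y.
have qr : (size q <= r)%N.
  apply/leq_sizeP => j rj; have [jl|lj] := ltnP j l.
    by have := y0 (Ordinal jl) rj; rewrite yq mxE.
  by rewrite nth_default// (leq_trans ql).
pose e n : R[i] := n%:R^-1.
have e0 : e n @[n --> \oo] --> (0 : R[i]) by apply: (@cvg_inv_natr R id).
(* (X / n)^r q(X - n), arranged so that only powers of e n = 1 / n occur *)
pose G n := (\sum_(j < r) (q`_j * e n ^+ (r - j)) *: (e n *: 'X - 1) ^+ j) * 'X^r.
have Gl n : (size (G n) <= l)%N.
  apply: (leq_trans (size_polyMleq _ _)); rewrite size_polyXn addnS/=.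
  rewrite -[l in (_ <= l)%N]odd_double_half -addnn -/r addnA leq_add2r.
  apply: leq_trans (leq_addl _ _).
  apply: (leq_trans (size_sum _ _ _)); apply/bigmax_leqP => j _.
  apply: (leq_trans (size_scale_leq _ _)).
  apply: (leq_trans (size_poly_exp_leq _ _)).
  have s2 : (size (e n *: 'X - 1 : {poly R[i]})%R <= 2)%N.
    rewrite (leq_trans (size_polyD _ _))// geq_max size_polyN size_poly1 andbT.
    by rewrite (leq_trans (size_scale_leq _ _))// size_polyX.
  have := ltn_ord j; move: s2; case: (size _) => [|[|[|]]]//= _; lia.
have e1 := @cvg_poly_ZXaddC R e (-1) e0.
exists (fun n => coef_vec l (G n)); split.
  have lim0 (i : nat) : (G n)`_i @[n --> \oo] -->
      ((\sum_(j < r) (0 : {poly R[i]})) * 'X^r)`_i; last first.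
    apply/cvg_mx_entries => i j; rewrite mxE; under eq_fun do rewrite mxE.
    by have := lim0 i; rewrite big1// mul0r coef0.
  apply: cvg_poly_mul i => i; last exact: cvg_cst.
  rewrite coef_sum; under eq_fun do rewrite coef_sum.
  apply: cvg_big => [|j _]; first exact: add_continuous.
  have qj : (fun=> q`_j) @ \oo --> q`_j by exact: cvg_cst.
  have lim0 := cvgM (cvgM qj (@cvg_exp_seq R _ _ (r - j) e0)) (@cvg_poly_exp R _ _ j e1 i).
  have rj : (r - j == 0)%N = false by have := ltn_ord j; lia.
  rewrite expr0n rj mulr0 mul0r in lim0.
  rewrite coef0; under eq_fun do rewrite coefZ -polyC1 -polyCN.
  exact: lim0.
have shifted : \forall n \near \oo,
    coef_vec l (q * (e n *: 'X + 1) ^+ r) = shift_mx R l ^+ n *m coef_vec l (G n).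
  near=> n.
  have n0 : (n%:R : R[i]) != 0.
    by rewrite pnatr_eq0 -lt0n; near: n; exact: nbhs_infty_gt.
  rewrite shift_mxXE//; congr coef_vec.
  have en : e n *: ('X + (n%:R)%:P) = e n *: 'X + 1 :> {poly R[i]}.
    by rewrite scalerDr -polyC1 -mul_polyC -[X in _ + X]mul_polyC -polyCM mulVf.
  rewrite comp_polyM [in RHS]rmorphXn/= comp_polyX -en exprZn -scalerAr scalerAl.
  congr (_ * _); rewrite rmorph_sum/=.
  have qE : q = \sum_(j < r) q`_j *: 'X^j.
    rewrite -poly_def; apply/polyP => i; rewrite coef_poly.
    by case: ltnP => // /(leq_trans qr) /leq_sizeP->.
  rewrite [in LHS]qE scaler_sumr; apply: eq_bigr => j _.
  rewrite comp_polyZ [X in _ = _ *: X]rmorphXn/= comp_polyB comp_polyZ comp_polyX.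
  rewrite en -polyC1 comp_polyC addrK exprZn !scalerA mulrC -mulrA -exprD subnK//.
  exact/ltnW.
apply: cvg_trans; first exact: (near_eq_cvg shifted).
have lim (i : nat) : (q * (e n *: 'X + 1) ^+ r)`_i @[n --> \oo] -->
    (q * 1 ^+ r)`_i.
  apply: cvg_poly_mul i => i; first exact: cvg_cst.
  apply: cvg_poly_exp i => i; exact: (@cvg_poly_ZXaddC R e 1 e0 i).
apply/cvg_mx_entries => i j; rewrite yq mxE; under eq_fun do rewrite mxE.
by have := lim i; rewrite expr1n mulr1.
Unshelve. all: by end_near. Qed.
(** * Jordan blocks *)

(** A Jordan block is a rescaled translation in other coordinates, because both
    are a scalar plus a regular nilpotent matrix. *)
Lemma jordan_block_shift (R : realType) l (lambda : R[i]) : lambda != 0 ->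
  exists E : 'M[R[i]]_l, [/\ E \in unitmx,
    (lambda *: shift_mx R l) *m E = E *m jordan_block l lambda &
    forall r y, coord_subspace r y <-> coord_subspace r (E *m y)].
Proof.
move=> l0; have rS := regular_upper_shift l l0.
have [E Eu SE] := regular_upper_similar rS.
exists E; split=> // r y.
rewrite (regular_upper_ker r y (regular_upper_jordan l lambda)).
rewrite (regular_upper_ker r (E *m y) rS).
set N := jordan_block l lambda - _; set N' := _ - _.
have NX a : N' ^+ a *m E = E *m N ^+ a.
  elim: a => [|a IHa]; first by rewrite mul1mx mulmx1.
  rewrite !exprS -[N * _]/(N *m _) -[N' * _]/(N' *m _) -mulmxA IHa !mulmxA.
  by rewrite mulmxBl SE mulmxBr mul_scalar_mx mul_mx_scalar.
rewrite mulmxA NX -mulmxA; split=> [->|Ey]; first by rewrite mulmx0.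
by rewrite -[LHS](mulKmx Eu) Ey mulmx0.
Qed.

Lemma limit_along_jordan_shift (R : realType) l (lambda : R[i]) k y (E : 'M[R[i]]_l) :
  `|lambda| = 1 -> E \in unitmx ->
  (lambda *: shift_mx R l) *m E = E *m jordan_block l lambda ->
  limit_along (jordan_block l lambda) k y <-> limit_along (shift_mx R l) k (E *m y).
Proof.
move=> l1 Eu SE; rewrite -(limit_along_scale (shift_mx R l) _ _ l1); split.
  exact: (limit_along_intertwine (esym SE)).
have ES : invmx E *m (lambda *: shift_mx R l) = jordan_block l lambda *m invmx E.
  by rewrite -[RHS](mulKmx Eu) [E *m (_ *m _)]mulmxA -SE mulmxK.
by move=> /(limit_along_intertwine ES); rewrite mulKmx.
Qed.

Lemma jordan_limit_upper (R : realType) l (lambda : R[i]) k y : `|lambda| = 1 ->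
  {homo k : m n / (m < n)%N} ->
  limit_along (jordan_block l lambda) k y -> coord_subspace l./2 y.
Proof.
move=> l1 kinc; have l0 : lambda != 0 by rewrite -normr_eq0 l1 oner_eq0.
have [E [Eu SE cE]] := jordan_block_shift l l0.
by rewrite (limit_along_jordan_shift _ _ l1 Eu SE) cE; exact: shift_limit_upper.
Qed.

Lemma jordan_limit_lower (R : realType) l (lambda : R[i]) y : `|lambda| = 1 ->
  coord_subspace l./2 y -> limit_along (jordan_block l lambda) id y.
Proof.
move=> l1; have l0 : lambda != 0 by rewrite -normr_eq0 l1 oner_eq0.
have [E [Eu SE cE]] := jordan_block_shift l l0.
by rewrite (limit_along_jordan_shift _ _ l1 Eu SE) cE; exact: shift_limit_lower.
Qed.

(** * Endomorphisms with unimodular spectrum *)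

(** A limit along any increasing exponents is a mixing limit: project it to a
    Jordan block by P, where this is known, and bring it back by E. Summing the
    idempotents E P to the identity gives the claim; the induction is on the rank
    of an idempotent e of the commutant, which drops when E P is removed. *)
Lemma limit_along_mixing (R : realType) n (B : 'M[R[i]]_n) k y :
  (forall (a : R[i]) (v : 'cV[R[i]]_n), v != 0 -> B *m v = a *: v -> `|a| = 1) ->
  {homo k : m n / (m < n)%N} ->
  limit_along B k y -> limit_along B id y.
Proof.
case: n B y => [|n] B y eigB kinc By.
  by rewrite [y](_ : _ = 0); [exact: limit_along0 | apply/colP => -[]].
suff idem (e : 'M[R[i]]_n.+1) : e *m e = e -> e *m B = B *m e ->
    limit_along B id (e *m y).
  by have := idem 1%:M; rewrite !mul1mx mulmx1; apply.
have [s] := ubnP (\rank e); elim: s e => [e es|s IHs e es ee eB].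
  by exfalso; rewrite ltn0 in es.
have [->|e0] := eqVneq e 0; first by rewrite mul0mx; exact: limit_along0.
have [m [lambda [E [P [m0 [v v0 Bv] [BE PB] [eE Pe] PE]]]]] :=
  jordan_summand ee eB e0.
have EPy : limit_along B id (E *m P *m y).
  rewrite -mulmxA; apply: limit_along_intertwine (esym BE) _.
  have l1 := eigB _ _ v0 Bv.
  apply: (jordan_limit_lower l1); apply: (jordan_limit_upper l1 kinc).
  exact: limit_along_intertwine PB By.
pose e' := e - E *m P.
have -> : e *m y = 1 *: (E *m P *m y) + e' *m y.
  by rewrite scale1r /e' mulmxBl addrC subrK.
have eEP : e *m (E *m P) = E *m P by rewrite mulmxA eE.
have EPe : E *m P *m e = E *m P by rewrite -mulmxA Pe.
have EPEP : E *m P *m (E *m P) = E *m P.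
  by rewrite mulmxA -[E *m P *m E]mulmxA PE mulmx1.
apply: (limit_along_linear 1 EPy); apply: IHs.
- rewrite -ltnS (leq_trans _ es)// ltnS; apply: rank_ltmx.
  rewrite ltmxE; apply/andP; split.
    by rewrite -[e'](_ : e' *m e = _) ?submxMl// mulmxBl ee EPe.
  apply/negP => /submxP[X eX].
  have EP0 : E *m P = 0.
    by rewrite -eEP eX -mulmxA mulmxBl eEP EPEP subrr mulmx0.
  have P0 : P = 0 by rewrite -[P]mul1mx -PE -mulmxA EP0 mulmx0.
  move/matrixP/(_ (Ordinal m0) (Ordinal m0)): PE.
  by rewrite P0 mul0mx !mxE eqxx => /esym/eqP; rewrite oner_eq0.
- by rewrite /e' mulmxBl !mulmxBr ee eEP EPe EPEP subrr subr0.
- by rewrite /e' mulmxBl mulmxBr eB -mulmxA PB !mulmxA BE.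
Qed.

(** A vspace of maximal dimension inside S must be all of S. *)
Lemma vspace_of_linear_set (K : fieldType) (V : vectType K) (S : set V) :
  S 0 -> (forall a u v, S u -> S v -> S (a *: u + v)) ->
  exists U : {vspace V}, S = [set` U].
Proof.
move=> S0 Slin.
pose P d := `[< exists2 U : {vspace V}, \dim U = d & [set` U] `<=` S >].
have Pex : exists d, P d.
  exists 0%N; apply/asboolP; exists 0%VS; first by rewrite dimv0.
  by move=> v /=; rewrite memv0 => /eqP->.
have Pub d : P d -> (d <= \dim {:V})%N.
  by move=> /asboolP[U <- _]; apply: dimvS; exact: subvf.
have [d /asboolP[U Ud US] dmax] := ex_maxnP Pex Pub.
exists U; apply/seteqP; split=> // v Sv /=.
have UvS : [set` (U + <[v]>)%VS] `<=` S.
  move=> w /= /memv_addP[u uU [_ /vlineP[a ->] ->]].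
  by rewrite addrC; apply: Slin => //; exact: US.
have := dmax _ (introT (asboolP _) (ex_intro2 _ _ (U + <[v]>)%VS erefl UvS)).
rewrite -Ud => le_dim.
have /eqP-> : (U == U + <[v]>)%VS by rewrite eqEdim addvSl.
exact: (subvP (addvSr U <[v]>) _ (memv_line v)).
Qed.
(** * Extended limit sets *)

Lemma iter_mulmx (R : realType) l (M : 'M[R[i]]_l) (T : 'cV[R[i]]_l -> 'cV[R[i]]_l) :
  (forall v, T v = M *m v) -> forall k v, iter k T v = M ^+ k *m v.
Proof.
move=> TM; elim=> [|k IHk] v; first by rewrite mul1mx.
by rewrite iterS IHk TM exprS mulmxA.
Qed.

Lemma extended_limit_setE (R : realType) l (M : 'M[R[i]]_l)
    (T : {linear 'cV[R[i]]_l -> 'cV[R[i]]_l}) y : (forall v, T v = M *m v) ->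
  extended_limit_set T 0 y <-> exists2 k,
    (forall n, (0 < k n)%N) /\ {homo k : m n / (m < n)%N} & limit_along M k y.
Proof.
move=> TM; split=> [[k [u [k0 kinc u0 uy]]]|[k [k0 kinc] [u [u0 uy]]]].
  exists k; first by split.
  exists u; split; first exact: u0.
  by move: uy; under eq_fun do rewrite (iter_mulmx TM).
exists k, u; split=> [|||]; [exact: k0 | exact: kinc | exact: u0 |].
by under eq_fun do rewrite (iter_mulmx TM).
Qed.

Lemma extended_mixing_limit_setE (R : realType) l (M : 'M[R[i]]_l)
    (T : {linear 'cV[R[i]]_l -> 'cV[R[i]]_l}) y : (forall v, T v = M *m v) ->
  extended_mixing_limit_set T 0 y <-> limit_along M id y.
Proof.
move=> TM; split=> [] [u [u0 uy]]; exists u; (split; first exact: u0).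
  by move: uy; under eq_fun do rewrite (iter_mulmx TM).
by under eq_fun do rewrite (iter_mulmx TM).
Qed.

(** The exponents are required to be positive, hence the shift by one. *)
Lemma limit_along_idW (R : realType) l (M : 'M[R[i]]_l) y :
  limit_along M id y -> exists2 k,
    (forall n, (0 < k n)%N) /\ {homo k : m n / (m < n)%N} & limit_along M k y.
Proof.
move=> [u [u0 uy]]; exists succn; first by split=> // m n mn; exact: mn.
exists (fun n => u n.+1); split.
  by rewrite -(cvg_shiftS u) in u0; exact: u0.
by rewrite -(cvg_shiftS (fun n => M ^+ n *m u n)) in uy; exact: uy.
Qed.

Lemma extended_limit_set_mixing (R : realType) l (M : 'M[R[i]]_l)
    (T : {linear 'cV[R[i]]_l -> 'cV[R[i]]_l}) y : (forall v, T v = M *m v) ->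
  (forall (a : R[i]) (v : 'cV[R[i]]_l), v != 0 -> M *m v = a *: v -> `|a| = 1) ->
  extended_limit_set T 0 y <-> limit_along M id y.
Proof.
move=> TM eigM; rewrite (extended_limit_setE y TM); split=> [[k [_ kinc]]|My].
  exact: limit_along_mixing.
exact: limit_along_idW.
Qed.

Lemma jordan_limit (R : realType) l (lambda : R[i]) : `|lambda| = 1 ->
  extended_limit_set (mulmx (jordan_block l lambda)) 0 = coord_subspace l./2 /\
  extended_mixing_limit_set (mulmx (jordan_block l lambda)) 0 = coord_subspace l./2.
Proof.
move=> l1; set J := jordan_block l lambda.
have JE (v : 'cV[R[i]]_l) : mulmx J v = J *m v by [].
have lower (y : 'cV[R[i]]_l) : coord_subspace l./2 y -> limit_along J id y.
  exact: jordan_limit_lower.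
split; apply/seteqP; split=> y.
- move=> /(extended_limit_setE y JE)[k [_ kinc]]; exact: jordan_limit_upper.
- move=> /lower Jy; apply/(extended_limit_setE y JE).
  exact: limit_along_idW.
- by move=> /(extended_mixing_limit_setE y JE); exact: jordan_limit_upper.
- by move=> /lower Jy; apply/(extended_mixing_limit_setE y JE).
Qed.

(** It is a subspace because it equals the mixing limit set. It is proper because
    a left eigenvector phi intertwines B with a 1 x 1 Jordan block, whose limit
    set is zero, so that phi vanishes on it. *)
Lemma extended_limit_set_vspace (R : realType) l
    (B : {linear 'cV[R[i]]_l -> 'cV[R[i]]_l}) : (0 < l)%N ->
  (forall (a : R[i]) (v : 'cV[R[i]]_l), v != 0 -> B v = a *: v -> `|a| = 1) ->
  exists V : {vspace 'cV[R[i]]_l},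
    extended_limit_set B 0 = [set` V] /\ V != fullv.
Proof.
move=> l0 eigB.
pose M : 'M[R[i]]_l := \matrix_(i, j) (B (delta_mx j 0)) i 0.
have BM (v : 'cV[R[i]]_l) : B v = M *m v.
  rewrite {1}[v]matrix_sum_delta linear_sum; apply/colP => i.
  rewrite summxE mxE; apply: eq_bigr => j _.
  by rewrite big_ord1 linearZ/= mxE mulrC mxE.
have eigM (a : R[i]) (v : 'cV[R[i]]_l) : v != 0 -> M *m v = a *: v -> `|a| = 1.
  by move=> v0; rewrite -BM; exact: eigB.
have BE y : extended_limit_set B 0 y <-> limit_along M id y.
  exact: extended_limit_set_mixing.
have [V VE] : exists V : {vspace 'cV[R[i]]_l}, limit_along M id = [set` V].
  apply: vspace_of_linear_set; first exact: limit_along0.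
  by move=> a u v; exact: limit_along_linear.
exists V; split; first by rewrite -VE; apply/seteqP; split=> y /BE.
have [a [phi phi0 phiM]] : exists a, exists2 phi : 'rV[R[i]]_l,
    phi != 0 & phi *m M = a *: phi.
  have /closed_rootP[a] : size (char_poly M) != 1%N.
    by rewrite size_char_poly eqSS -lt0n.
  rewrite -eigenvalue_root_char => /eigenvalueP[phi phiM phi0].
  by exists a, phi.
have a1 : `|a| = 1.
  have : eigenvalue M^T a.
    have : eigenvalue M a by apply/eigenvalueP; exists phi.
    rewrite /eigenvalue /eigenspace !kermx_eq0 !row_free_unit -unitmx_tr.
    by rewrite linearB/= tr_scalar_mx.
  move=> /eigenvalueP[v vM v0]; apply: (eigM a v^T).
    by rewrite trmx_eq0.
  by apply: trmx_inj; rewrite trmx_mul trmxK vM linearZ/= trmxK.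
apply: contraNneq phi0 => VT; apply/eqP/rowP => j.
have Mj : limit_along M id (delta_mx j 0 : 'cV[R[i]]_l).
  have -> : limit_along M id = [set` V] by [].
  by rewrite /= VT memvf.
have phiJ : phi *m M = jordan_block 1 a *m phi.
  by rewrite phiM -mul_scalar_mx; congr (_ *m _); apply/matrixP => i k; rewrite !mxE !ord1.
have := jordan_limit_upper a1 (fun _ _ => id) (limit_along_intertwine phiJ Mj).
by move=> /(_ 0 isT); rewrite -colE !mxE.
Qed.

Theorem theorem2p2 (R : realType) (l : nat) (hl : (1 <= l)%N)
    (lambda : R[i]) (hlambda : `|lambda| = 1) :
  let A := jordan_block l lambda in
  [/\ (l = 1%N -> extended_limit_set (mulmx A) 0 = [set 0]) /\
      ((1 < l)%N -> forall r : nat, (0 < r)%N ->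
         l = (2 * r)%N \/ l = (2 * r + 1)%N ->
         extended_limit_set (mulmx A) 0 = coord_subspace r),
      (forall y : 'cV[R[i]]_l,
         extended_limit_set (mulmx A) 0 y <->
         exists x : nat -> 'cV[R[i]]_l,
           x n @[n --> \oo] --> (0 : 'cV[R[i]]_l) /\
           A ^+ n *m x n @[n --> \oo] --> y) /\
      extended_limit_set (mulmx A) 0 = extended_mixing_limit_set (mulmx A) 0 &
      forall B : {linear 'cV[R[i]]_l -> 'cV[R[i]]_l},
        (forall a : R[i], passmx.leigenvalue (linfun B) a -> `|a| = 1) ->
        exists V : {vspace 'cV[R[i]]_l},
          extended_limit_set B 0 = [set` V] /\ V != fullv].
Proof.
move=> A; have [JA JmixA] := jordan_limit l hlambda.
split; [split | split | ].
- move=> l1; rewrite JA l1; apply/seteqP; split=> y /=.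
    by move=> y0; apply/colP => i; rewrite y0 ?mxE.
  by move=> -> i _; rewrite mxE.
- by move=> _ r _ lr; rewrite JA; congr coord_subspace; lia.
- move=> y; rewrite JA -JmixA.
  exact: (@extended_mixing_limit_setE _ _ A (mulmx A) y (fun=> erefl)).
- by rewrite JA JmixA.
- move=> B eigB; apply: extended_limit_set_vspace => // a v v0 Bv.
  apply: eigB; apply: contraNneq v0 => ker0.
  rewrite -memv0 -ker0 memv_ker; apply/eqP.
  by rewrite add_lfunE opp_lfunE scale_lfunE !lfunE/= Bv subrr.
Qed.
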